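(* Let $n\ge 6$ and $i\in[n-1]$. Then \[\max\{d_\ell(\sigma,\rho):\sigma,\rho\in\mathcal{D}(\{i\};n),\ \sigma\ne\rho\}=\begin{cases} n-2 & \text{for } i=1 \text{ or } i=n-1,\\ n-i & \text{for } i=2,3,\ldots,\lfloor n/2\rfloor,\\ i & \text{for } i=\lceil n/2\rceil,\lceil n/2\rceil+1,\ldots,n-2.\end{cases}\]
   Context: $S_n$ is the symmetric group on $[n]=\{1,\ldots,n\}$, with permutations in one-line notation $\sigma=\sigma_1\cdots\sigma_n$. The descent set of $\sigma$ is $\mathcal{D}(\sigma)=\{j\in[n-1]:\sigma_j>\sigma_{j+1}\}$, and for $S\subseteq[n-1]$, $\mathcal{D}(S;n)=\{\sigma\in S_n:\mathcal{D}(\sigma)=S\}$. The $\ell_\infty$-metric is $d_\ell(\sigma,\rho)=\max\{|\sigma_j-\rho_j|:1\le j\le n\}$. *)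

(* Defs.v *)
From mathcomp Require Import all_boot all_order all_fingroup all_algebra.

Set Implicit Arguments.
Unset Strict Implicit.
Unset Printing Implicit Defensive.

(* The one-line entry sigma_(k+1) is (s k) + 1 for k : 'I_n; shifting all     *)
(* values by one affects neither their order nor their differences.           *)

(* Descent positions keep their 1-based names: [n-1] is the set of nonzero    *)
(* elements of 'I_n, so for j = k + 1 the entries sigma_j and sigma_(j+1) are *)
(* s k and s j, up to the shift of values. 0 is never in the descent set.     *)
Definition descent_set n (s : 'S_n) : {set 'I_n} :=
  [set j : 'I_n | [exists k : 'I_n, (k.+1 == j :> nat) && (s j < s k)]].

Definition descent_class n (S : {set 'I_n}) : {set 'S_n} :=
  [set s : 'S_n | descent_set s == S].

Definition linf_dist n (s r : 'S_n) : nat := \max_(j < n) `|s j - r j|%N.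

(* Main.v *)
Require Import Defs.
From mathcomp Require Import all_boot all_order all_fingroup all_algebra.
From mathcomp Require Import zify.

(** A permutation with descent set [{i}] increases on the positions before [i]
    and on those from [i] on. Counting the entries on either side inside a block
    confines the entry at position [k] of the first block to
    [[k, n - i + k]], and the one at position [i + k] of the second block to
    [[k, i + k]], so two such permutations are at distance at most
    [max (n - i) i]. The bound is reached by comparing the two-block swap with
    a permutation in which a single entry leaves its place. When a block has
    only one position, the descent itself excludes one more value there. *)

Lemma mem_descent_class1P n (i : 'I_n) (s : 'S_n) : 0 < i ->
  reflect (forall k j : 'I_n, k.+1 = j -> (s j < s k) = (j == i))
          (s \in descent_class [set i]).
Proof.
move=> i_gt0; rewrite inE.
apply: (iffP eqP) => [/setP dsi k j kj | ds].
  have := dsi j; rewrite !inE => <-; apply/idP/existsP => [lt_s | [k' /andP[]]].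
    by exists k; rewrite kj eqxx.
  by rewrite -kj eqSS => /eqP/val_inj ->.
apply/setP => j; rewrite !inE; apply/existsP/idP.
  by case=> k /andP[/eqP kj]; rewrite (ds k j kj).
move=> /eqP ->{j}; have lt_pi : i.-1 < n by have := ltn_ord i; lia.
by exists (Ordinal lt_pi); rewrite (ds _ i) /= prednK ?eqxx.
Qed.

(** Inside one block there is no descent, so each step to the right raises the entry by at least 1.
    The disjunction says that [j] and [k] lie in the same block. *)
Lemma descent_class1_growth n (i : 'I_n) (s : 'S_n) (j k : 'I_n) :
    0 < i -> s \in descent_class [set i] ->
  j <= k -> (k < i) || (i <= j) -> s j + (k - j) <= s k.
Proof.
move=> i_gt0 /(mem_descent_class1P _ _ _ i_gt0) ds.
move: {2}(k - j) (erefl (k - j)) => d; elim: d k => [|d IHd] k dE le_jk blk.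
  by rewrite (_ : k = j) ?subnn ?addn0 //; apply: val_inj => /=; lia.
have lt_pk : k.-1 < n by have := ltn_ord k; lia.
have := IHd (Ordinal lt_pk) => /=.
have kE : (Ordinal lt_pk).+1 = k by move=> /=; lia.
have := ds _ _ kE; rewrite (_ : (k == i) = false); last first.
  by apply/eqP => /(congr1 val) /=; lia.
(* The absence of a descent gives only a weak inequality; injectivity makes it strict. *)
have : s (Ordinal lt_pk) != s k :> nat.
  by rewrite (inj_eq val_inj) (inj_eq perm_inj) -(inj_eq val_inj) /=; lia.
lia.
Qed.

(** Growth from position 0, whose entry is at least 0, gives the lower bound; growth up to position
    [i.-1], whose entry is at most [n.-1], gives the upper one. *)
Lemma descent_class1_first_block n (i : 'I_n) (s : 'S_n) (k : 'I_n) :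
    0 < i -> s \in descent_class [set i] ->
  k < i -> k <= s k <= n - i + k.
Proof.
move=> i_gt0 ds lt_ki; have lt_in := ltn_ord i.
have n_gt0 : 0 < n by lia.
have lt_pi : i.-1 < n by lia.
have := descent_class1_growth n i s (Ordinal n_gt0) k i_gt0 ds.
have := descent_class1_growth n i s k (Ordinal lt_pi) i_gt0 ds.
have := ltn_ord (s (Ordinal lt_pi)) => /=; lia.
Qed.

Lemma descent_class1_second_block n (i : 'I_n) (s : 'S_n) (k : 'I_n) :
    0 < i -> s \in descent_class [set i] ->
  i <= k -> k - i <= s k <= k.
Proof.
move=> i_gt0 ds le_ik; have lt_in := ltn_ord i; have lt_kn := ltn_ord k.
have lt_pn : n.-1 < n by lia.
have := descent_class1_growth n i s i k i_gt0 ds.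
have := descent_class1_growth n i s k (Ordinal lt_pn) i_gt0 ds.
have := ltn_ord (s (Ordinal lt_pn)) => /=; lia.
Qed.

Lemma descent_class1_pred n (i : 'I_n) (s : 'S_n) (k : 'I_n) :
  0 < i -> s \in descent_class [set i] -> k.+1 = i -> s i < s k.
Proof.
by move=> i_gt0 /(mem_descent_class1P _ _ _ i_gt0) ds /ds ->; rewrite eqxx.
Qed.

(** Describing a permutation by a function on [nat] leaves only arithmetic conditions, which [lia]
    settles for the three explicit permutations below. *)
Lemma descent_class1_of_fun n (i : 'I_n) (f : nat -> nat) :
    0 < i -> (forall k, k < n -> f k < n) ->
    (forall j k, j < n -> k < n -> f j = f k -> j = k) ->
    (forall k, k.+1 < n -> (f k.+1 < f k) = (k.+1 == i)) ->
  exists2 s : 'S_n, s \in descent_class [set i] &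
    forall k : 'I_n, s k = f k :> nat.
Proof.
move=> i_gt0 f_lt f_inj f_desc.
pose g (k : 'I_n) := Ordinal (f_lt k (ltn_ord k)).
have g_inj : injective g.
  by move=> j k /(congr1 val) /= /f_inj jk; apply: val_inj; apply: jk.
exists (perm g_inj) => [|k]; last by rewrite permE.
apply/mem_descent_class1P => // k j kj; rewrite !permE /= -kj f_desc ?kj //.
Qed.

(** This permutation is extremal everywhere: it attains the upper bound throughout the first block
    and the lower bound throughout the second. *)
Lemma block_swap_exists n (i : 'I_n) : 0 < i ->
  exists2 s : 'S_n, s \in descent_class [set i] &
    forall k : 'I_n, s k = (if k < i then n - i + k else k - i) :> nat.
Proof.
have lt_in := ltn_ord i => i_gt0.
apply: (descent_class1_of_fun n i (fun k => if k < i then n - i + k else k - i))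
  => // [k|j k|k] /=; do ?case: ifP; lia.
Qed.

(** The identity with its largest value moved to the end of the first block. *)
Lemma max_moved_exists n (i : 'I_n) : 0 < i ->
  exists2 s : 'S_n, s \in descent_class [set i] &
    forall k : 'I_n,
      s k = (if k.+1 < i then k : nat else if k < i then n.-1 else k.-1) :> nat.
Proof.
have lt_in := ltn_ord i => i_gt0.
apply: (descent_class1_of_fun n i
          (fun k => if k.+1 < i then k else if k < i then n.-1 else k.-1))
  => // [k|j k|k] /=; do ?case: ifP; lia.
Qed.

(** The identity with its smallest value moved to the start of the second block. *)
Lemma min_moved_exists n (i : 'I_n) : 0 < i ->
  exists2 s : 'S_n, s \in descent_class [set i] &
    forall k : 'I_n,
      s k = (if k < i then k.+1 else if k == i :> nat then 0 else k) :> nat.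
Proof.
have lt_in := ltn_ord i => i_gt0.
apply: (descent_class1_of_fun n i
          (fun k => if k < i then k.+1 else if k == i :> nat then 0 else k))
  => // [k|j k|k] /=; do ?case: ifP; lia.
Qed.

Lemma max_linf_dist_eq n (A : {set 'S_n}) (d : nat) (s r : 'S_n) (j : 'I_n) :
    0 < d -> s \in A -> r \in A -> `|s j - r j|%N = d ->
    (forall s r k, s \in A -> r \in A -> `|s k - r k|%N <= d) ->
  \max_(p : 'S_n * 'S_n | [&& p.1 \in A, p.2 \in A & p.1 != p.2])
     linf_dist p.1 p.2 = d.
Proof.
move=> d_gt0 sA rA srj le_d; apply/eqP; rewrite eqn_leq; apply/andP; split.
  apply/bigmax_leqP => p /and3P[p1 p2 _].
  by apply/bigmax_leqP => k _; apply: le_d.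
(* Positivity of [d] makes the pair distinct, hence admissible in the maximum. *)
have neq_sr : s != r by apply: contraTneq d_gt0 => srE; rewrite -srj srE distnn.
apply: (@leq_trans (linf_dist s r)).
  by rewrite -srj; apply: (leq_bigmax j).
by apply: (bigmax_sup (s, r)) => //=; rewrite sA rA.
Qed.

Theorem theorem4p2 (n : nat) (i : 'I_n) (hn : 6 <= n) (hi : 0 < i) :
  let m := \max_(p : 'S_n * 'S_n | [&& p.1 \in descent_class [set i],
                                       p.2 \in descent_class [set i]
                                     & p.1 != p.2]) linf_dist p.1 p.2 in
  [/\ (i = 1 :> nat \/ i = n - 1 :> nat) -> m = n - 2,
      2 <= i <= n./2 -> m = n - i
    & uphalf n <= i <= n - 2 -> m = i].
Proof.
move=> m; have lt_in := ltn_ord i.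
have n_gt0 : 0 < n by lia.
have lt_pn : n.-1 < n by lia.
have [t tD tE] := block_swap_exists n i hi.
have [u uD uE] := max_moved_exists n i hi.
have [v vD vE] := min_moved_exists n i hi.
have bnd s r k : s \in descent_class [set i] -> r \in descent_class [set i] ->
    `|s k - r k|%N <= (if k < i then n - i else i).
  move=> sD rD; case: ltnP => [lt_ki|le_ik].
    have := descent_class1_first_block n i s k hi sD lt_ki.
    have := descent_class1_first_block n i r k hi rD lt_ki; lia.
  have := descent_class1_second_block n i s k hi sD le_ik.
  have := descent_class1_second_block n i r k hi rD le_ik; lia.
split=> [[i1|i_last] | i_small | i_large].
- apply: (max_linf_dist_eq n _ _ t v (Ordinal n_gt0)) => //; first by lia.
    by rewrite tE vE /=; do ?case: ifP; lia.
  move=> s r k sD rD; have /leq_trans := bnd s r k sD rD.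
  case: ifP => [lt_ki _|_]; last by apply; lia.
  (* Here [k] is position 0; the descent forces its entry to be at least 1, so both entries lie in
     [[1, n - 1]]. *)
  have ki : k.+1 = i by lia.
  have := descent_class1_pred n i s k hi sD ki.
  have := descent_class1_pred n i r k hi rD ki.
  have := ltn_ord (s k); have := ltn_ord (r k); lia.
- apply: (max_linf_dist_eq n _ _ t u (Ordinal lt_pn)) => //; first by lia.
    by rewrite tE uE /=; do ?case: ifP; lia.
  move=> s r k sD rD; have /leq_trans := bnd s r k sD rD.
  case: ifP => [_|le_ik _]; first by apply; lia.
  (* Dually, the last entry lies below its predecessor, hence in [[0, n - 2]]. *)
  have -> : k = i by apply: val_inj; have := ltn_ord k => /=; lia.
  have lt_pi : i.-1 < n by lia.
  have iE : (Ordinal lt_pi).+1 = i by move=> /=; lia.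
  have := descent_class1_pred n i s _ hi sD iE.
  have := descent_class1_pred n i r _ hi rD iE.
  have := ltn_ord (s (Ordinal lt_pi)); have := ltn_ord (r (Ordinal lt_pi)); lia.
- apply: (max_linf_dist_eq n _ _ t u (Ordinal n_gt0)) => //; first by lia.
    (* At position 0 the entries are [n - i] and, because [2 <= i], 0. *)
    by rewrite tE uE /=; do ?case: ifP; lia.
  move=> s r k sD rD; apply: leq_trans (bnd s r k sD rD) _.
  by case: ifP; lia.
- apply: (max_linf_dist_eq n _ _ t v (Ordinal lt_pn)) => //.
    (* At the last position the entries are [n - 1 - i] and, because [i <= n - 2], [n - 1]. *)
    by rewrite tE vE /=; do ?case: ifP; lia.
  move=> s r k sD rD; apply: leq_trans (bnd s r k sD rD) _.
  by case: ifP; lia.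
Qed.
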